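(* Let $(c_n)_{n\in\mathbb{N}}$ be a sequence of natural numbers and $x=(x_i)_{i\in\mathbb{N}}$ a sequence of real numbers. Let $(\epsilon^1_i)_{i\in\mathbb{N}}$ be i.i.d. uniform on $[-1/2,1/2]$ and, for $\beta_1\in\mathbb{R}$, let $Y^1_i:=\beta_1x_i+\epsilon^1_i$. Suppose one observes $(x_i,\tilde Y_i)_{i\le n}$, where $\tilde Y_1,\dots,\tilde Y_n$ are obtained from $Y^1_1,\dots,Y^1_n$ by (adversarially) perturbing $c_n$ of the values. If there exist $c,o\in(0,1)$ and $\bar n\in\mathbb{N}$ such that for all $n\ge\bar n$ \[ p_n:=\sum_{i=1}^n\min\{1,c|x_i|\}<c_n(1-o), \] then there does not exist a consistent estimator for $\beta_1$ (i.e. no sequence of estimators based on $(x_i,\tilde Y_i)_{i\le n}$ converges in probability to $\beta_1$ for every value of the parameter and every such adversarial perturbation). *)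

(* Defs.v *)
From HB Require Import structures.
From mathcomp Require Import all_boot all_order all_algebra.
From mathcomp Require Import all_classical all_reals all_analysis.
Set Implicit Arguments. Unset Strict Implicit. Unset Printing Implicit Defensive.
Import Order.TTheory GRing.Theory Num.Theory.
Import numFieldNormedType.Exports.
Local Open Scope classical_set_scope.
Local Open Scope ring_scope.

Lemma half_lt_half (R : realType) : (- (1/2) : R) < 1/2.
Proof. by rewrite gtrN // divr_gt0. Qed.

(* The noise (eps_i)_i is i.i.d. uniform on [-1/2, 1/2]:
   each eps_i is measurable, has law uniform_prob on [-1/2,1/2],
   and the family is mutually independent (product rule on every finite
   prefix; taking A_i = setT gives any finite subfamily). *)
Definition iid_uniform_noise (R : realType) d (Omega : measurableType d)
  (P : probability Omega R) (eps : nat -> Omega -> R) : Prop :=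
  [/\ (forall i, measurable_fun setT (eps i)),
      (forall i (A : set R), measurable A ->
         P (eps i @^-1` A) = uniform_prob (half_lt_half R) A) &
      (forall (n : nat) (A : nat -> set R), (forall i, measurable (A i)) ->
         P (\bigcap_(i in `I_n) (eps i @^-1` A i)) =
         (\prod_(i < n) P (eps i @^-1` A i))%E)].

Definition clean_response (R : realType) d (Omega : measurableType d)
  (x : nat -> R) (eps : nat -> Omega -> R) (beta1 : R) (i : nat) (w : Omega) : R :=
  beta1 * x i + eps i w.

(* An adversarial perturbation of the sample: for every sample size n, a
   (measurable) random vector Ytilde_n of length n that differs from
   (Y^1_0, ..., Y^1_{n-1}) in at most c_n coordinates, pointwise on Omega.
   The adversary may depend on beta1 and on anything on Omega. *)
Definition adversarial_perturbation (R : realType) d (Omega : measurableType d)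
  (cn : nat -> nat) (x : nat -> R) (eps : nat -> Omega -> R) (beta1 : R)
  (Yt : forall n : nat, Omega -> n.-tuple R) : Prop :=
  forall n : nat, measurable_fun setT (Yt n) /\
    forall w : Omega,
      (#|[set i : 'I_n | tnth (Yt n w) i != clean_response x eps beta1 i w]|
         <= cn n)%N.

(* An estimator sequence: measurable maps from the observed sample of size n
   to R (x is fixed and known, so dependence on it is implicit). *)
Definition estimator_seq (R : realType) :=
  forall n : nat, n.-tuple R -> R.

Definition cvg_in_prob (R : realType) d (Omega : measurableType d)
  (P : probability Omega R) (Z : nat -> Omega -> R) (b : R) : Prop :=
  forall delta : R, 0 < delta ->
    (fun n => P [set w | delta < `| Z n w - b |]) @ \oo --> 0%E.

Definition consistent_estimator (R : realType) d (Omega : measurableType d)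
  (P : probability Omega R) (cn : nat -> nat) (x : nat -> R)
  (eps : nat -> Omega -> R) (T : estimator_seq R) : Prop :=
  (forall n, measurable_fun setT (T n)) /\
  forall (beta1 : R) (Yt : forall n : nat, Omega -> n.-tuple R),
    adversarial_perturbation cn x eps beta1 Yt ->
    cvg_in_prob P (fun n w => T n (Yt n w)) beta1.

(* Main.v *)
Require Import Defs.
From HB Require Import structures.
From mathcomp Require Import all_boot all_order all_algebra.
From mathcomp Require Import all_classical all_reals all_analysis.
From mathcomp Require Import measurable_realfun lra.
Import Order.TTheory GRing.Theory Num.Theory.
Import numFieldNormedType.Exports.
Local Open Scope classical_set_scope.
Local Open Scope ring_scope.

(** Le Cam's two-point argument with [beta1 = 0] and [beta1 = c].  Translation
    by [c * x i] modulo 1 preserves the law of the noise [eps i], and differs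
    from the plain translation with probability at most [min 1 (c * |x i|)].
    When [beta1 = c], the adversary outputs these wrapped values whenever this
    changes at most [cn n] coordinates, and leaves the sample untouched otherwise.
    By Markov's inequality the first case has probability at least [o], and
    the wrapped sample has the law of the clean sample for [beta1 = 0].  An
    estimator close to [0] under that law is then far from [c] with probability
    bounded away from zero. *)

(** * Translations and rotations of the uniform law *)

Lemma measurable_neqr (R : realType) d (T : measurableType d) (f g : T -> R) :
  measurable_fun setT f -> measurable_fun setT g ->
  measurable [set w | f w != g w].
Proof.
move=> mf mg; have := measurable_fun_eqr mf mg measurableT (I : measurable [set false]).
by rewrite setTI; congr measurable; apply/seteqP; split => w /=; case: eqP.
Qed.

Lemma measurable_shift {R : realType} (t : R) :
  measurable_fun setT (fun u : R => u + t).
Proof. by apply: measurable_funD. Qed.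

(** The pushforward by the translation gives half-open intervals their length, which characterises
    Lebesgue measure. *)
Lemma lebesgue_measure_shift {R : realType} (t : R) (A : set R) :
  measurable A ->
  lebesgue_measure ((fun u : R => u + t) @^-1` A) = lebesgue_measure A.
Proof.
move=> mA.
pose f : measurableTypeR R -> measurableTypeR R := fun u => u + t.
have mf : measurable_fun setT f by exact: measurable_shift.
apply/esym; transitivity (pushforward lebesgue_measure f A); last by [].
apply: lebesgue_measure_unique => //= _ [[a b]] _ <-; rewrite /pushforward.
have -> : f @^-1` `]a, b] = `](a - t), (b - t)]%classic.
  by apply/seteqP; split => u /=; rewrite /f !in_itv/= ltrBlDr lerBrDr.
by rewrite !lebesgue_measure_itv/= !lte_fin ltrD2r; case: ifPn => // _;
  rewrite -!EFinB; congr (_%:E); lra.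
Qed.

(** The density is 1 and the endpoint [- (1/2)] is null. Dropping it leaves an interval that splits
    exactly into two half-open pieces, which a rotation exchanges. *)
Lemma uniform_prob_half (R : realType) (A : set R) : measurable A ->
  uniform_prob (half_lt_half R) A =
  lebesgue_measure (A `&` `](- (1/2)), (1/2)]).
Proof.
move=> mA; rewrite /uniform_prob integral_uniform_pdf.
rewrite (eq_integral (fun=> 1%E)); last first.
  move=> u; rewrite inE => -[_ /=]; rewrite in_itv/= => u01.
  rewrite /uniform_pdf u01 (_ : 1/2 - - (1/2) = 1) ?invr1//; lra.
rewrite integral_cst ?mul1e//; last exact: measurableI.
rewrite -(@setU1itv _ _ _ _ false); last by rewrite bnd_simp; lra.
rewrite setIUr measureU//; [|exact: measurableI|exact: measurableI|].
- rewrite [X in (X + _)%E](_ : _ = 0)%E ?add0e//.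
  apply/eqP; rewrite -measure_le0; rewrite -(lebesgue_measure_set1 (- (1/2) : R)).
  by apply: le_measure; rewrite ?inE; [exact: measurableI| |exact: subIsetr].
- apply/seteqP; split => u //= -[[_ ->] [_]]; rewrite in_itv/=; lra.
Qed.

(* Translation by [t] modulo 1 on ]-1/2, 1/2], for [t] in [0, 1]. *)
Definition rotation {R : realType} (t u : R) : R :=
  if u <= 1/2 - t then u + t else u + (t - 1).

Lemma measurable_rotation {R : realType} (t : R) :
  measurable_fun setT (rotation t).
Proof.
apply: measurable_fun_ifT; [exact: measurable_fun_ler| |]; exact: measurable_shift.
Qed.

(** The two branches translate the pieces below and above [1/2 - t] onto the ranges of [H] and [L]
    respectively, and each translation preserves Lebesgue measure. *)
Lemma uniform_prob_rotation {R : realType} (t : R) (A : set R) :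
  0 <= t <= 1 -> measurable A ->
  uniform_prob (half_lt_half R) (rotation t @^-1` A) =
  uniform_prob (half_lt_half R) A.
Proof.
move=> t01 mA.
have mrA : measurable (rotation t @^-1` A).
  by rewrite -[X in measurable X]setTI; exact: measurable_rotation.
rewrite !uniform_prob_half//.
pose L : set R := A `&` `](- (1/2)), (t - 1/2)].
pose H : set R := A `&` `](t - 1/2), (1/2)].
have mL : measurable L by exact: measurableI.
have mH : measurable H by exact: measurableI.
have mpre s B : measurable B -> measurable ((fun u : R => u + s) @^-1` B).
  by move=> mB; rewrite -[X in measurable X]setTI; exact: measurable_shift.
transitivity (lebesgue_measure (((fun u : R => u + t) @^-1` H) `|`
   ((fun u : R => u + (t - 1)) @^-1` L))).
  congr (lebesgue_measure _); apply/seteqP; split => u; rewrite /H /L /=.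
    rewrite /rotation !in_itv/=; case: ifPn => ut [Au u01]; [left|right]; split => //; lra.
  rewrite /rotation !in_itv/=; case: ifPn => ut [[Au u01]|[Au u01]]; split => //; lra.
rewrite measureU//=; [|exact: mpre|exact: mpre|]; last first.
  by apply/seteqP; split => u //; rewrite /H /L /= !in_itv/=; lra.
rewrite !lebesgue_measure_shift// -measureU//.
  congr (lebesgue_measure _); rewrite /H /L -setIUr; congr (_ `&` _).
  apply/seteqP; split => u /=; rewrite !in_itv/=; first lra.
  by move=> u01; case: (ltP (t - 1/2) u) => ?; [left|right]; lra.
by apply/seteqP; split => u //; rewrite /H /L /= !in_itv/=; lra.
Qed.

Lemma uniform_prob_itv_le (R : realType) (a b : R) (A : set R) : a <= b ->
  measurable A ->
  A `&` `](- (1/2)), (1/2)] `<=` `]a, b] ->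
  (uniform_prob (half_lt_half R) A <= (b - a)%:E)%E.
Proof.
move=> ab mA Aab; rewrite uniform_prob_half//.
apply: (@le_trans _ _ (lebesgue_measure `]a, b]%classic)).
  by apply: le_measure; rewrite ?inE//; exact: measurableI.
by rewrite lebesgue_measure_itv/= lte_fin; case: ifPn => // _; rewrite lee_fin subr_ge0.
Qed.

(* The total variation distance between the uniform law and its translate by
   [s] is min(1, |s|); here it is attained by a deterministic coupling. *)
Lemma exists_uniform_coupling (R : realType) (s : R) :
  exists g : R -> R, [/\ measurable_fun setT g,
    (forall A, measurable A -> uniform_prob (half_lt_half R) (g @^-1` A) =
                               uniform_prob (half_lt_half R) A) &
    (uniform_prob (half_lt_half R) [set u | (g u != u + s)%R]
      <= (Num.min 1 `|s|)%:E)%E].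
Proof.
have mne (g : R -> R) : measurable_fun setT g -> measurable [set u : R | g u != u + s].
  by move=> mg; exact: measurable_neqr mg (measurable_shift s).
have [s1|s1] := leP 1 `|s|.
  (* The bound is 1 here, so any law-preserving map will do. *)
  exists id; split => //.
  apply: (@probability_le1 _ _ _ (uniform_prob (half_lt_half R))); exact: mne.
have [s0|s0] := leP 0 s.
  rewrite ger0_norm// in s1 *.
  (* Wrapping occurs only on []1/2 - s, 1/2]], of length [s]. *)
  exists (rotation s); split; first exact: measurable_rotation.
    by move=> A mA; apply: uniform_prob_rotation => //; lra.
  rewrite (_ : s%:E = (1/2 - (1/2 - s))%:E); last by congr (_%:E); lra.
  apply: uniform_prob_itv_le; [lra|exact: mne (measurable_rotation _)|].
  move=> u [/=]; rewrite /rotation !in_itv/=; case: ifPn; rewrite ?eqxx//; lra.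
rewrite ltr0_norm// in s1 *.
(* Modulo 1, [s] and [s + 1] agree: the upper branch adds exactly [s], so the maps differ only on
   []-1/2, -1/2 - s]], of length [- s]. *)
exists (rotation (s + 1)); split; first exact: measurable_rotation.
  by move=> A mA; apply: uniform_prob_rotation => //; lra.
rewrite (_ : (- s)%:E = ((- (1/2) - s) - (- (1/2)))%:E); last by congr (_%:E); lra.
apply: uniform_prob_itv_le; [lra|exact: mne (measurable_rotation _)|].
move=> u [/=]; rewrite /rotation !in_itv/=; case: ifPn => [ut _|_]; first lra.
by rewrite addrK eqxx.
Qed.

(** * Laws of random vectors and a tail bound for counts *)

(** Boxes are stable under intersection and generate the product sigma-algebra, so they determine a
    probability law. *)
Lemma tuple_law_unique (R : realType) d1 d2 d (T1 : measurableType d1)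
    (T2 : measurableType d2) (T : measurableType d)
    (P1 : probability T1 R) (P2 : probability T2 R) (n : nat)
    (X1 : T1 -> n.-tuple T) (X2 : T2 -> n.-tuple T) :
  measurable_fun setT X1 -> measurable_fun setT X2 ->
  (forall A : 'I_n -> set T, (forall i, measurable (A i)) ->
    P1 (X1 @^-1` [set t | forall i, A i (tnth t i)]) =
    P2 (X2 @^-1` [set t | forall i, A i (tnth t i)])) ->
  forall B, measurable B -> P1 (X1 @^-1` B) = P2 (X2 @^-1` B).
Proof.
move=> mX1 mX2 Q12 B mB.
pose G : set (set (n.-tuple T)) := [set C | exists2 A : 'I_n -> set T,
  (forall i, measurable (A i)) & C = [set t | forall i, A i (tnth t i)]].
have GT : G setT by exists (fun=> setT) => //; apply/seteqP; split.
transitivity (pushforward P1 X1 B); first by [].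
transitivity (pushforward P2 X2 B); last by [].
apply: (@measure_unique _ _ _ G (fun=> setT)) => //.
- apply/seteqP; split; last first.
    apply: smallest_sub; first exact: sigma_algebra_measurable.
    move=> _ [A mA ->].
    rewrite (_ : mkset _ = \big[setI/setT]_(i < n) ((@tnth n T)^~ i @^-1` A i)).
      apply: bigsetI_measurable => i _.
      by rewrite -[X in measurable X]setTI; exact: measurable_tnth.
    rewrite -bigcap_seq; apply/seteqP; split => t tA i //=.
    by apply: (tA i); rewrite /= mem_index_enum.
  apply: smallest_sub; first exact: smallest_sigma_algebra.
  rewrite -bigcup_seq => _ [i _ [A mA <-]]; apply: sub_sigma_algebra.
  (* A cylinder over coordinate [i] is a box with full sides elsewhere. *)
  exists (fun j => if j == i then A else setT); first by move=> j; case: ifP.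
  apply/seteqP; split => t /=; first by move=> -[_ At] j; case: eqP => // ->.
  by move=> /(_ i); rewrite eqxx; split.
- move=> _ _ [A mA ->] [A' mA' ->]; exists (fun i => A i `&` A' i).
    by move=> i; exact: measurableI.
  by apply/seteqP; split => [t [tA tA'] i|t tAA'] ; split => // i; have [] := tAA' i.
- by rewrite bigcup_const.
- by move=> _ [A mA ->]; exact: Q12.
- move=> _; rewrite [ltLHS](_ : _ = 1%E) ?ltry//; exact: (probability_setT P1).
Qed.

(** Markov's inequality for the number of events that occur, whose integral is computed by
    linearity. The product form allows [m] to be zero. *)
Lemma markov_count (R : realType) d (T : measurableType d)
    (mu : {measure set T -> \bar R}) (n : nat) (B : 'I_n -> set T) (m : nat) :
  (forall i, measurable (B i)) ->
  (m%:R%:E * mu [set w | (m%:R < \sum_(i < n) \1_(B i) w :> R)%R]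
    <= \sum_(i < n) mu (B i))%E.
Proof.
move=> mB.
pose N (w : T) : R := \sum_(i < n) \1_(B i) w.
have mN : measurable_fun setT N by apply: measurable_sum => i; exact: measurable_indic.
have mE : measurable [set w | m%:R < N w].
  rewrite -[X in measurable X]setTI.
  rewrite (_ : mkset _ = N @^-1` `]m%:R, +oo[); first exact: mN.
  by apply/seteqP; split => w /=; rewrite in_itv/= andbT.
rewrite -/N.
apply: (@le_trans _ _ (\int[mu]_w (N w)%:E)%E).
  rewrite -(setIT [set w | _]) -integral_indic//.
  rewrite -ge0_integralZl//; last first.
    by apply/measurable_EFinP; exact: measurable_indic.
  apply: ge0_le_integral => //=.
  - by apply/measurable_EFinP/measurable_funM => //; exact: measurable_indic.
  - by apply/measurable_EFinP.
  - move=> w _; rewrite -EFinM lee_fin indicE.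
    case: (boolP (w \in _)) => [|_]; rewrite ?mulr0 ?mulr1; last exact: sumr_ge0.
    by rewrite inE => /ltW.
under eq_integral do rewrite /N -sumEFin.
rewrite ge0_integral_sum//.
- by apply: lee_sum => i _; rewrite integral_indic// setIT.
- by move=> i; apply/measurable_EFinP; exact: measurable_indic.
Qed.

Theorem theoremE1 (R : realType) (d : measure_display) (Omega : measurableType d)
  (P : probability Omega R) (eps : nat -> Omega -> R)
  (cn : nat -> nat) (x : nat -> R) :
  iid_uniform_noise P eps ->
  (exists (c o : R) (nbar : nat),
     [/\ 0 < c < 1, 0 < o < 1 &
      forall n : nat, (nbar <= n)%N ->
        \sum_(i < n) Num.min 1 (c * `| x i |) < (cn n)%:R * (1 - o)]) ->
  ~ exists T : estimator_seq R, consistent_estimator P cn x eps T.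
Proof.
move=> [meps law indep] [c [q [nbar [/andP[c0 c1] /andP[q0 q1] pn]]]] [T [mT consT]].
have [g gP] := choice (fun i => @exists_uniform_coupling R (c * x i)).
pose mg i : measurable_fun setT (g i) := let: And3 h _ _ := gP i in h.
pose Z i w := g i (eps i w).
pose Y i w := clean_response x eps c i w.
have mZ i : measurable_fun setT (Z i) by exact: measurableT_comp (mg i) (meps i).
have mY i : measurable_fun setT (Y i).
  by rewrite /Y /clean_response; exact: measurable_funD.
pose Zt n w := [tuple Z i w | i < n].
pose et n w := [tuple eps i w | i < n].
pose B i : set Omega := [set w | Z i w != Y i w].
pose N n (w : Omega) : R := \sum_(i < n) \1_(B i) w.
have mB i : measurable (B i) by exact: measurable_neqr.
have mN n : measurable_fun setT (N n).
  by apply: measurable_sum => i; exact: measurable_indic.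
(* Testing [N] makes the budget hold at every outcome, as the definition of a perturbation
   demands. *)
pose Yt n w := if N n w <= (cn n)%:R then Zt n w else [tuple Y i w | i < n].
have PB i : (P (B i) <= (Num.min 1 (c * `|x i|))%:E)%E.
  have [_ _] := gP i; rewrite normrM (gtr0_norm c0); apply: le_trans.
  rewrite -(law i).
    rewrite (_ : B i = eps i @^-1` [set u | g i u != u + c * x i])//.
    by apply/seteqP; split => w; rewrite /B/= /Z /Y /clean_response addrC.
  exact: measurable_neqr (mg i) (measurable_shift _).
have NE n w : N n w = #|[set i : 'I_n | Z i w != Y i w]|%:R.
  rewrite /N -sum1_card natr_sum [RHS]big_mkcond/=; apply: eq_bigr => i _.
  rewrite indicE [X in if X then _ else _](_ : _ = (w \in B i)) ?inE//.
  by case: (w \in B i).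
have mZt n : measurable_fun setT (Zt n).
  apply/measurable_fun_tnthP => i; rewrite (_ : _ \o _ = Z i)//.
  by apply/funext => w /=; rewrite tnth_mktuple.
have met n : measurable_fun setT (et n).
  apply/measurable_fun_tnthP => i; rewrite (_ : _ \o _ = eps i)//.
  by apply/funext => w /=; rewrite tnth_mktuple.
have mE n : measurable [set w | N n w <= (cn n)%:R].
  rewrite -[X in measurable X]setTI (_ : mkset _ = N n @^-1` `]-oo, (cn n)%:R])//.
  exact: mN.
(* For slope 0 the clean responses are the noise itself. *)
have adv0 : adversarial_perturbation cn x eps 0 et.
  move=> n; split => // w; rewrite eq_card0// => i.
  by rewrite memNset//= tnth_mktuple /clean_response mul0r add0r eqxx.
have advc : adversarial_perturbation cn x eps c Yt.
  move=> n; split.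
    apply: measurable_fun_ifT; [exact: measurable_fun_ler|exact: mZt|].
    apply/measurable_fun_tnthP => i; rewrite (_ : _ \o _ = Y i)//.
    by apply/funext => w /=; rewrite tnth_mktuple.
  move=> w; rewrite /Yt; case: ifPn => [|_].
    rewrite NE ler_nat; congr (_ <= _)%N; congr #|in_set _|.
    by apply/seteqP; split => i /=; rewrite tnth_mktuple.
  rewrite eq_card0// => i.
  by rewrite memNset//= tnth_mktuple eqxx.
have lawZ n (A : set (n.-tuple R)) : measurable A ->
    P (Zt n @^-1` A) = P (et n @^-1` A).
  apply: tuple_law_unique => // {}A mA.
  (* [indep] takes sets indexed by all of [nat], hence the extension by [setT] past [n]. *)
  pose A' j := if insub j is Some i then A i else setT.
  have A'E (i : 'I_n) : A' i = A i by rewrite /A' valK.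
  have mA' j : measurable (A' j) by rewrite /A'; case: insub.
  transitivity (P (\bigcap_(i in `I_n) (eps i @^-1` (g i @^-1` A' i)))).
    congr (P _); apply/seteqP; split => w /= h i.
      by move=> ni; have := h (Ordinal ni); rewrite tnth_mktuple -A'E.
    by rewrite tnth_mktuple -A'E; move: (h i (ltn_ord i)).
  transitivity (P (\bigcap_(i in `I_n) (eps i @^-1` A' i))); last first.
    congr (P _); apply/seteqP; split => w /= h i.
      by rewrite tnth_mktuple -A'E; exact: (h i (ltn_ord i)).
    by move=> ni; have := h (Ordinal ni); rewrite tnth_mktuple -A'E.
  have mgA i : measurable (g i @^-1` A' i).
    by rewrite -[X in measurable X]setTI; exact: mg.
  rewrite (indep n (fun i => g i @^-1` A' i) mgA) (indep n A' mA').
  apply: eq_bigr => i _; rewrite !law//.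
  by have [_ -> //] := gP i.
have PE n : (nbar <= n)%N -> (q%:E <= P [set w | (N n w <= (cn n)%:R)%R])%E.
  move=> /pn pnn.
  have E0 : [set w | N n w <= (cn n)%:R] = ~` [set w | (cn n)%:R < N n w].
    by apply/seteqP; split => w /=; rewrite leNgt => /negP.
  have mD : measurable [set w | (cn n)%:R < N n w].
    by rewrite -[X in measurable X]setCK -E0; exact: measurableC.
  rewrite E0 probability_setC//.
  have : ((cn n)%:R%:E * P [set w | ((cn n)%:R < N n w)%R] <=
      \sum_(i < n) P (B i))%E by exact: markov_count.
  move=> /le_trans /(_ (lee_sum _ (fun (i : 'I_n) _ => PB i))).
  rewrite sumEFin; set Q := P _.
  have : Q \is a fin_num by exact: fin_num_measure.
  case: Q => // r _; rewrite -EFinM -EFinB !lee_fin => /le_lt_trans /(_ pnn).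
  (* If [cn n] were 0, the nonnegative sum in [pnn] would be less than 0. Positivity allows
     cancelling [cn n], which leaves [r < 1 - q]. *)
  have c0' : 0 < (cn n)%:R :> R.
    rewrite ltNge; apply/negP => cn0; move: pnn; apply/negP; rewrite -leNgt.
    apply: (@le_trans _ _ 0); first by rewrite mulr_le0_ge0// subr_ge0 ltW.
    by apply: sumr_ge0 => i _; rewrite le_min ler01 mulr_ge0// ltW.
  by rewrite ltr_pM2l// => ?; lra.
(* Balls of radius [c / 3] about 0 and [c] are disjoint. *)
have c3 : 0 < c / 3 by lra.
have cvg0 := consT 0 et adv0 _ c3.
have cvgc := consT c Yt advc _ c3.
(* Two events of probability below [q / 2] cannot cover the event of [PE], whose probability is at
   least [q]. *)
have q20 : (0 < (q / 2)%:E :> \bar R)%E by rewrite lte_fin; lra.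
suff [n [nn Pn0 Pnc]] : exists n, [/\ (nbar <= n)%N,
    (P [set w | (c / 3 < `|T n (et n w) - 0|)%R] < (q / 2)%:E)%E &
    (P [set w | (c / 3 < `|T n (Yt n w) - c|)%R] < (q / 2)%:E)%E].
  have := PE n nn; apply/negP; rewrite -ltNge.
  pose U0 : set (n.-tuple R) := [set t | c / 3 < `|T n t - 0|].
  pose Uc : set (n.-tuple R) := [set t | c / 3 < `|T n t - c|].
  have mU b : measurable [set t : n.-tuple R | c / 3 < `|T n t - b|].
    rewrite -[X in measurable X]setTI.
    rewrite (_ : mkset _ = (fun t => `|T n t - b|) @^-1` `]c / 3, +oo[); last first.
      by apply/seteqP; split => t /=; rewrite in_itv/= andbT.
    have mTb : measurable_fun setT (fun t => `|T n t - b|).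
      apply: (measurableT_comp (@normr_measurable R setT)).
      exact: (measurable_funB (mT n) (measurable_cst b)).
    exact: mTb.
  have mYt : measurable_fun setT (Yt n) by have [] := advc n.
  have mZU : measurable (Zt n @^-1` U0).
    by rewrite -[X in measurable X]setTI; apply: mZt => //; exact: mU.
  have mYU : measurable (Yt n @^-1` Uc).
    by rewrite -[X in measurable X]setTI; apply: mYt => //; exact: mU.
  apply: (@le_lt_trans _ _ (P (Zt n @^-1` U0 `|` Yt n @^-1` Uc))).
    apply: le_measure; rewrite ?inE//; first exact: measurableU.
    (* Within the budget [Yt] equals [Zt], and a single estimate cannot be within [c / 3] of both
       slopes. *)
    move=> w /= Nw; rewrite /Uc /Yt /= Nw /U0/=.
    case: (ltP (c / 3) `|T n (Zt n w) - 0|) => [|h]; first by left.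
    right; move: h; rewrite subr0 ler_norml => /andP[h1 h2].
    by rewrite ltr0_norm; lra.
  apply: (@le_lt_trans _ _ (P (Zt n @^-1` U0) + P (Yt n @^-1` Uc))%E).
    exact: measureU2.
  (* Equality of laws turns this term into the error probability of the estimator at slope 0. *)
  rewrite lawZ; last exact: mU.
  rewrite (_ : q%:E = ((q / 2)%:E + (q / 2)%:E)%E); first exact: lteD.
  by rewrite -EFinD; congr (_%:E); lra.
have small (u : nat -> \bar R) : u @ \oo --> 0%E ->
    \forall n \near \oo, (u n < (q / 2)%:E)%E.
  by move=> u0; exact: u0 (open_ereal_lt' q20).
near \oo => n; exists n; split.
- by near: n; exact: nbhs_infty_ge.
- by near: n; exact: small cvg0.
- by near: n; exact: small cvgc.
Unshelve. all: by end_near. Qed.
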